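(* The cohomology of the complex $\mathcal K^\bullet(A,A)$ satisfies $H^i(\mathcal K^\bullet(A,A))=0$ for $i=0,1,\dots,m-1$, and \[\dim_{\mathbb C(\lambda)}H^m(\mathcal K^\bullet(A,A))=\sum_{B\subseteq A}(-1)^{|A\setminus B|}\,|\mathcal B\cap C(B)|.\]
   Context: Let $A=\{\mathbf a_1,\dots,\mathbf a_m\}\subseteq\mathbb Z^n$ be linearly independent over $\mathbb R$, $\mathbf a_0\in\mathbb Z^n$, and $\ell_0,\dots,\ell_m$ positive integers with gcd $1$, $\ell_0\mathbf a_0=\sum_{j=1}^m\ell_j\mathbf a_j$, $\ell_0=\sum_{j=1}^m\ell_j$. Let $V$ be the real span of $A$, $V_{\mathbb Z}=V\cap\mathbb Z^n$, $C(B)$ the closed real cone generated by a subset $B\subseteq A$ (with $C(\emptyset)=\{0\}$), $M=V_{\mathbb Z}\cap C(A)$. Let $S'$ be the $\mathbb C(\lambda)$-span of $\{x^u:u\in M\}$ in $\mathbb C(\lambda)[x_1^{\pm1},\dots,x_n^{\pm1}]$. For $u\in M$ write $u=\sum_{j=1}^mu'_j\mathbf a_j$, and define $\mathbb C(\lambda)$-linear operators $\tilde D_j$ on $S'$ ($j=1,\dots,m$) by $\tilde D_j(x^u)=u'_jx^u+\ell_jx^u(x^{\mathbf a_j}-\lambda x^{\mathbf a_0})$ (these are the operators $\sum_l\beta_{jl}D_l$, $D_l=x_l\partial/\partial x_l+x_l\partial f_\lambda/\partial x_l$, $f_\lambda=\sum_j\ell_jx^{\mathbf a_j}-\ell_0\lambda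 x^{\mathbf a_0}$, for a rational matrix $\beta$ with $\beta\alpha=\binom{I_m}{0}$, $\alpha$ the matrix with columns $\mathbf a_j$). For $T\subseteq A$ let $S'_{A,T}$ be the $\mathbb C(\lambda)$-span of those $x^u$, $u\in M$, with $u'_j>0$ whenever $\mathbf a_j\in T$. Define the complex $\mathcal K^\bullet(A,A)$ by $\mathcal K^k(A,A)=\bigoplus_{j_1<\dots<j_k}S'_{A,\{\mathbf a_{j_1},\dots,\mathbf a_{j_k}\}}\,e_{j_1}\wedge\dots\wedge e_{j_k}$ with differential $\nabla(\xi\,e_{j_1}\wedge\dots\wedge e_{j_k})=\big(\sum_{j=1}^m\tilde D_j(\xi)e_j\big)\wedge e_{j_1}\wedge\dots\wedge e_{j_k}$ (a subcomplex of the Koszul complex of $S'$ with respect to $\tilde D_1,\dots,\tilde D_m$). Let $P(A)=\{\sum_jc_j\mathbf a_j:0\le c_j<1\}$ and $\mathcal B=V_{\mathbb Z}\cap P(A)$. *)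

(* Defs.v *)
(* C(lambda) is modelled as the fraction field of {poly R[i]}
   for an arbitrary R : realType (R[i] = complex numbers over R). *)
From mathcomp Require Import all_boot all_order all_algebra.
From mathcomp Require Import reals.
From mathcomp.real_closed Require Import complex.
Set Implicit Arguments. Unset Strict Implicit. Unset Printing Implicit Defensive.
Import GRing.Theory Num.Theory.
Local Open Scope ring_scope.

Definition Clam (R : realType) : fieldType := {fraction {poly R[i]}}.
Definition lam (R : realType) : Clam R := tofrac 'X.
Definition realF (R : realType) (x : R) : Clam R := tofrac ((x%:C)%C%:P).

(* Data: A given by the m x n integer matrix amat whose rows are a_1..a_m;
   exponents are integer row vectors 'rV[int]_n. *)
Notation expo n := ('rV[int]_n).
Definition intmxR (R : realType) p q (M : 'M[int]_(p, q)) : 'M[R]_(p, q) :=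
  map_mx (fun z : int => z%:~R) M.

Definition in_cone (R : realType) n m (amat : 'M[int]_(m, n)) (B : {set 'I_m})
  (u : expo n) : Prop :=
  exists c : 'rV[R]_m, (forall j, 0 <= c 0 j) /\ (forall j, j \notin B -> c 0 j = 0) /\
    intmxR R u = c *m intmxR R amat.

Definition in_M (R : realType) n m (amat : 'M[int]_(m, n)) (u : expo n) : Prop :=
  in_cone R amat setT u.

Definition in_Bset (R : realType) n m (amat : 'M[int]_(m, n)) (u : expo n) : Prop :=
  exists c : 'rV[R]_m, (forall j, 0 <= c 0 j < 1) /\ intmxR R u = c *m intmxR R amat.

(* coordinate u'_j of u in the basis A (unique for u in V by independence) *)
Definition coord (R : realType) n m (amat : 'M[int]_(m, n)) (u : expo n) (j : 'I_m) : R :=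
  (intmxR R u *m pinvmx (intmxR R amat)) 0 j.

(* Elements of S' are finitely supported coefficient functions u |-> coeff of x^u *)
Definition finsupp (F : nzRingType) n (xi : expo n -> F) : Prop :=
  exists s : seq (expo n), forall u, xi u != 0 -> u \in s.

Definition in_S (R : realType) n m (amat : 'M[int]_(m, n)) (T : {set 'I_m})
  (xi : expo n -> Clam R) : Prop :=
  finsupp xi /\ forall u, xi u != 0 ->
    in_M R amat u /\ forall j, j \in T -> 0 < coord R amat u j.

(* tilde D_j (x^u) = u'_j x^u + l_j x^u (x^{a_j} - lambda x^{a_0}) *)
Definition Dt (R : realType) n m (amat : 'M[int]_(m, n)) (a0 : expo n) (l : 'I_m -> nat)
  (j : 'I_m) (xi : expo n -> Clam R) : expo n -> Clam R :=
  fun u => realF (coord R amat u j) * xi u + (l j)%:R * xi (u - row j amat)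
           - (l j)%:R * lam R * xi (u - a0).

(* A k-form: omega J = coefficient of e_J (J a subset of indices); K^k membership *)
Definition form (R : realType) n m := {set 'I_m} -> expo n -> Clam R.

Definition in_K (R : realType) n m (amat : 'M[int]_(m, n)) (k : nat) (w : form R n m) : Prop :=
  forall J : {set 'I_m}, if #|J| == k then in_S amat J (w J) else forall u, w J u = 0.

(* nabla(xi e_J) = (sum_j Dt_j xi e_j) /\ e_J ;  e_j /\ e_J = (-1)^#{i in J | i < j} e_{J+j} *)
Definition nabla (R : realType) n m (amat : 'M[int]_(m, n)) (a0 : expo n) (l : 'I_m -> nat)
  (w : form R n m) : form R n m :=
  fun K u => \sum_(j in K) (-1) ^+ #|[set i in K | (i < j)%N]|
                             * Dt amat a0 l j (w (K :\ j)) u.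

Definition eqform (R : realType) n m (w w' : form R n m) : Prop :=
  forall J u, w J u = w' J u.

Definition cocycle (R : realType) n m (amat : 'M[int]_(m, n)) a0 l k (w : form R n m) :=
  in_K amat k w /\ eqform (nabla amat a0 l w) (fun _ _ => 0).

Definition coboundary (R : realType) n m (amat : 'M[int]_(m, n)) a0 l k (w : form R n m) :=
  if k is k'.+1 then exists v, in_K amat k' v /\ eqform (nabla amat a0 l v) w
  else eqform w (fun _ _ => 0).

Definition H_vanishes (R : realType) n m (amat : 'M[int]_(m, n)) a0 l k :=
  forall w : form R n m, cocycle amat a0 l k w -> coboundary amat a0 l k w.

Definition lincomb (R : realType) n m d (c : 'I_d -> Clam R) (v : 'I_d -> form R n m)
  : form R n m := fun J u => \sum_(i < d) c i * v i J u.

Definition H_dim (R : realType) n m (amat : 'M[int]_(m, n)) a0 l k (d : nat) :=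
  exists v : 'I_d -> form R n m,
    (forall i, cocycle amat a0 l k (v i)) /\
    (forall w, cocycle amat a0 l k w -> exists c : 'I_d -> Clam R,
        coboundary amat a0 l k (fun J u => w J u - lincomb c v J u)) /\
    (forall c : 'I_d -> Clam R, coboundary amat a0 l k (lincomb c v) -> forall i, c i = 0).

Definition counts n (P : expo n -> Prop) (N : nat) : Prop :=
  exists s : seq (expo n), uniq s /\ (forall u, u \in s <-> P u) /\ size s = N.

(* Main.v *)
(* Index the basis monomial x^u e_J by v = u - sum_(j in J) a_j, of weight
   sum_j v'_j. For lambda = 0 the weight-preserving part of the differential is
   x^u e_J |-> sum_j l_j x^(u + a_j) e_j /\ e_J, which fixes v; for each v it is
   the cochain complex of a cube, contractible as soon as some v'_j >= 0, and
   reduced to one top form x^u e_A with 0 < u'_j < 1 otherwise. Let H be the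
   contraction in such a direction j and P the projection onto the remaining
   forms. Then Phi = nabla H + H nabla + P is, at lambda = 0, the identity plus
   terms coming from strictly larger weight. On the (finite dimensional) pieces
   of bounded weight its determinant is a polynomial in lambda with value 1 at
   0, so Phi is bijective over C(lambda). Since Phi commutes with nabla up to P,
   this yields exactness below degree m and shows that the monomials of the open
   box form a basis of H^m. The alternating sum counts them by Moebius inversion
   over the support. *)
From Pilot Require Import Defs.
From mathcomp Require Import all_boot all_order all_algebra.
From mathcomp Require Import reals boolp ring lra zify.
From mathcomp.real_closed Require Import complex.
Set Implicit Arguments. Unset Strict Implicit. Unset Printing Implicit Defensive.
Import Order.TTheory GRing.Theory Num.Theory.
Local Open Scope ring_scope.

(** * Signs of wedge products and sums over subsets *)

Section Signs.
Variable m : nat.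
Implicit Types (K J S : {set 'I_m}) (i j : 'I_m).

(* e_j /\ e_J = (-1)^(before K j) e_K when K is J with j added. *)
Definition before K j := #|[set i in K | (i < j)%N]|.

Lemma before_setD1 K i j : i \in K ->
  before K j = ((i < j) + before (K :\ i) j)%N.
Proof.
move=> iK; rewrite /before (cardsD1 i) !inE iK /=; congr (_ + #|pred_of_set _|)%N.
by apply/setP=> x; rewrite !inE andbA.
Qed.

(** Deleting the smaller of i, j lowers the position of the larger by one, while deleting the larger
    leaves the position of the smaller unchanged, so the two orders differ by one sign. *)
Lemma sign_swap (F : pzRingType) K i j : i \in K -> j \in K -> i != j ->
  (-1) ^+ before K i * (-1) ^+ before (K :\ i) j
  = - ((-1) ^+ before K j * (-1) ^+ before (K :\ j) i) :> F.
Proof.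
move=> iK jK; rewrite neq_ltn => ltij.
rewrite (@before_setD1 K i j) // (@before_setD1 K j i) //.
rewrite -!exprD -!addnA [(before (K :\ i) j + _)%N]addnC.
case/orP: ltij => lt; rewrite lt ltnNge (ltnW lt) /= add0n ?add1n.
  by rewrite exprS mulN1r opprK.
by rewrite exprS mulN1r.
Qed.

Lemma sum_antisym (V : zmodType) (K : {set 'I_m}) (f : 'I_m -> 'I_m -> V) :
  (forall i j, i \in K -> j \in K -> i != j -> f i j = - f j i) ->
  \sum_(i in K) \sum_(j in K :\ i) f i j = 0.
Proof.
move=> fN.
have split_sum i : \sum_(j in K :\ i) f i j =
    \sum_(j in K | (i < j)%N) f i j + \sum_(j in K | (j < i)%N) f i j.
  rewrite (bigID (fun j : 'I_m => (i < j)%N)) /=; congr (_ + _);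
    apply: eq_bigl => j; rewrite !inE -val_eqE neq_ltn.
    by case: (ssrnat.ltngtP i j); rewrite ?andbF ?andbT /= ?andbF ?andbT.
  by case: (ssrnat.ltngtP i j); rewrite ?andbF ?andbT /= ?andbF ?andbT.
rewrite (eq_bigr _ (fun i _ => split_sum i)) big_split /=.
rewrite [X in _ + X](exchange_big_dep (mem K)) /=; last by move=> i j _ /andP[].
rewrite -big_split big1 //= => i iK; apply/eqP; rewrite addr_eq0 -sumrN; apply/eqP.
apply: eq_big => [j|j /andP[jK ltij]]; first by rewrite iK.
by apply: fN => //; rewrite neq_ltn ltij.
Qed.

(** Expand the product over i of 1 + g_i, with g_i = 0 on S and g_i = -1 off S. Here B is the set of
    factors contributing their 1, and a B that does not contain S contributes 0. *)
Lemma sum_superset_sign S :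
  \sum_(B : {set 'I_m} | S \subset B) (-1) ^+ (m - #|B|)%N = (S == setT)%:Z.
Proof.
have := bigA_distr (1 : int) +%R (fun i : 'I_m => 1 : int)
  (fun i => if i \in S then 0 else - 1).
rewrite (eq_bigr (fun i => (i \in S)%:Z)); last by move=> i _; case: ifP.
have -> : \prod_i (i \in S)%:Z = (S == setT)%:Z :> int.
  case: eqP => [->|/eqP SnT]; first by rewrite big1 // => i _; rewrite inE.
  have [i iS] : exists i, i \notin S.
    apply/existsP; apply: contraR SnT; rewrite negb_exists => /forallP nS.
    by rewrite eqEsubset subsetT; apply/subsetP => i _; apply/negPn/nS.
  by rewrite (bigD1 i) //= (negPf iS) mul0r.
move=> ->; rewrite [RHS](bigID (fun B : {set 'I_m} => S \subset B)) /=.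
rewrite [X in _ = _ + X]big1 ?addr0; last first.
  move=> B /subsetPn[i iS iB]; rewrite (bigD1 i) //= (negPf iB) iS.
  by rewrite mul0r.
apply: eq_bigr => B SB.
rewrite (eq_bigr (fun i => if i \in ~: B then -1 else 1)); last first.
  move=> i _; rewrite inE; case: ifP => //= iB.
  by rewrite (contraFF (subsetP SB i) iB).
rewrite -big_mkcond prodr_const; congr (_ ^+ _).
by rewrite -[X in (X - _)%N]card_ord -(cardsC B) addKn.
Qed.

End Signs.

(** * Invertibility criteria and finiteness *)

Lemma unitriangular_unit (K : fieldType) (R : realType) N (Q : 'M[K]_N) (wt : 'I_N -> R) :
  (forall i j, wt j <= wt i -> Q i j = (i == j)%:R) -> Q \in unitmx.
Proof.
move=> QE; rewrite -row_free_unit; apply: inj_row_free => v vQ0.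
apply/eqP; apply: contraT => /rV0Pn[i0 vi0].
(* At an index of minimal weight in the support of v, only the diagonal entry of Q contributes to v
   Q. *)
have [j vj jmin] := @arg_minP _ _ _ i0 (fun i => v 0 i != 0) wt vi0.
have := congr1 (fun M : 'rV_N => M 0 j) vQ0; rewrite !mxE (bigD1 j) //= QE // eqxx mulr1.
rewrite big1 ?addr0 => [/eqP|i ij]; first by rewrite (negPf vj).
have [->|vi] := eqVneq (v 0 i) 0; first by rewrite mul0r.
by rewrite QE ?jmin // (negPf ij) mulr0.
Qed.

(** The determinant is a polynomial with nonzero value at 0, hence a nonzero polynomial. *)
Lemma unitmx_tofrac (K : fieldType) N (Q : 'M[{poly K}]_N) :
  map_mx (horner_eval 0) Q \in unitmx -> map_mx (@tofrac _) Q \in unitmx.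
Proof.
rewrite !unitmxE !det_map_mx !unitfE tofrac_eq0.
by apply: contraNneq => ->; rewrite rmorph0.
Qed.

Lemma bounded_int_rows n (b : nat) : exists s : seq 'rV[int]_n,
  forall u : 'rV[int]_n, (forall q, `|u 0 q| <= b%:Z) -> u \in s.
Proof.
exists [seq \row_q ((f q : nat)%:Z - b%:Z) | f : {ffun 'I_n -> 'I_(2 * b).+1}].
move=> u ub; apply/mapP; exists [ffun q => inord `|u 0 q + b%:Z|]; first by rewrite mem_enum.
apply/rowP => q; rewrite mxE ffunE; have := ub q; rewrite ler_norml => /andP[lo hi].
have ub0 : 0 <= u 0 q + b%:Z by rewrite -lerBlDr sub0r.
rewrite inordK ?gez0_abs ?addrK // -ltz_nat gez0_abs //. lia.
Qed.

Lemma count_int_sum (T : Type) (a : pred T) (s : seq T) :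
  (count a s)%:Z = \sum_(x <- s) (a x)%:Z.
Proof. by elim: s => [|x s IHs]; rewrite ?big_nil // big_cons -IHs -PoszD. Qed.

(** * Coordinates with respect to A *)

Section Operators.
Variables (R : realType) (n m : nat) (amat : 'M[int]_(m, n)) (a0 : expo n).
Variables (l0 : nat) (l : 'I_m -> nat).
Hypothesis free_amat : row_free (intmxR R amat).
Hypothesis l0_gt0 : (0 < l0)%N.
Hypothesis l_gt0 : forall j, (0 < l j)%N.
Hypothesis l0a0 : (l0%:Z) *: a0 = \sum_(j < m) (l j)%:Z *: row j amat.
Hypothesis l0_sum : l0 = (\sum_(j < m) l j)%N.
Implicit Types (K J : {set 'I_m}) (i j : 'I_m) (u : expo n).

Local Notation crd u j := (Pilot.Defs.coord R amat u j).

Definition inV u := (intmxR R u <= intmxR R amat)%MS.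

Lemma intmxRD p q (A B : 'M_(p, q)) : intmxR R (A + B) = intmxR R A + intmxR R B.
Proof. by rewrite /intmxR map_mxD. Qed.
Lemma intmxRB p q (A B : 'M_(p, q)) : intmxR R (A - B) = intmxR R A - intmxR R B.
Proof. by rewrite /intmxR map_mxB. Qed.

Lemma coordD u v j : crd (u + v) j = crd u j + crd v j.
Proof. by rewrite /Defs.coord intmxRD mulmxDl mxE. Qed.

Lemma coordB u v j : crd (u - v) j = crd u j - crd v j.
Proof. by rewrite /Defs.coord intmxRB mulmxBl !mxE. Qed.

Lemma coord_cone u (c : 'rV_m) : intmxR R u = c *m intmxR R amat ->
  forall j, crd u j = c 0 j.
Proof. by move=> uc j; rewrite /Defs.coord uc mulmxKp. Qed.

Lemma inVP u : reflect (intmxR R u = (\row_j crd u j) *m intmxR R amat) (inV u).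
Proof.
apply: (iffP idP) => [uV|uE]; last by rewrite /inV uE submxMl.
apply: (etrans (esym (mulmxKpV uV))); congr (_ *m _).
by apply/rowP => j; rewrite [RHS]mxE.
Qed.

Lemma coord_row i j : crd (row i amat) j = (i == j)%:R.
Proof.
rewrite (@coord_cone _ (delta_mx 0 i)) ?mxE ?eqxx 1?eq_sym //.
by rewrite -rowE /intmxR map_row.
Qed.

Lemma inV_row i : inV (row i amat).
Proof. by rewrite /inV /intmxR map_row row_sub. Qed.

Lemma a0E : intmxR R a0 = (\row_j ((l j)%:R / l0%:R)) *m intmxR R amat.
Proof.
have l0U : l0%:R != 0 :> R by rewrite pnatr_eq0 -lt0n.
apply: (scalerI l0U).
have -> : l0%:R *: intmxR R a0 = intmxR R (l0%:Z *: a0).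
  by apply/matrixP => p q; rewrite !mxE rmorphM.
rewrite l0a0 scalemxAl.
have -> : l0%:R *: (\row_j ((l j)%:R / l0%:R)) = \row_j (l j)%:R :> 'rV[R]_m.
  by apply/rowP => j; rewrite !mxE mulrC divfK.
apply/rowP => q; rewrite !mxE summxE rmorph_sum.
by apply: eq_bigr => j _; rewrite !mxE rmorphM.
Qed.

Lemma coord_a0 j : crd a0 j = (l j)%:R / l0%:R.
Proof. by rewrite (coord_cone a0E) mxE. Qed.

Lemma inV_a0 : inV a0.
Proof. by rewrite /inV a0E submxMl. Qed.

Lemma inVD u v : inV u -> inV v -> inV (u + v).
Proof. by move=> uV vV; rewrite /inV intmxRD addmx_sub. Qed.
Lemma inVB u v : inV u -> inV v -> inV (u - v).
Proof. by move=> uV vV; rewrite /inV intmxRB addmx_sub // eqmx_opp. Qed.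

(** * Differential and homotopy over a general coefficient ring *)

Section Generic.
Variables (F : comPzRingType) (phi : {rmorphism R -> F}) (lm : F).
Implicit Types (xi : expo n -> F) (w : {set 'I_m} -> expo n -> F).

(** At [phiF] and [lam R] this is [Dt], and [Dform] is [nabla], by conversion; later proofs pass
    between them silently. *)
Definition Dop j xi : expo n -> F :=
  fun u => phi (crd u j) * xi u + (l j)%:R * xi (u - row j amat)
           - (l j)%:R * lm * xi (u - a0).

Definition Dform w : {set 'I_m} -> expo n -> F :=
  fun K u => \sum_(j in K) (-1) ^+ before K j * Dop j (w (K :\ j)) u.

(* The test is v'_j >= 0 for v = u - sum_(j in J) a_j. *)
Definition freeidx J u := [pick j | (j \in J)%:R <= crd u j].

(** The sign and the inverse of [l j] undo x^u e_J |-> l_j x^(u + a_j) e_j /\ e_J in the chosen free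
    direction j. *)
Definition Hform w : {set 'I_m} -> expo n -> F :=
  fun J u => if freeidx J u is Some j then
    if j \in J then 0 else
    (-1) ^+ before (j |: J) j * phi ((l j)%:R^-1) * w (j |: J) (u + row j amat)
  else 0.

Definition Pform w : {set 'I_m} -> expo n -> F :=
  fun J u => if freeidx J u then 0 else w J u.

Definition Phi w : {set 'I_m} -> expo n -> F :=
  fun J u => Dform (Hform w) J u + Hform (Dform w) J u + Pform w J u.

(** Shifting by a_j changes coordinate i only if i = j; shifting by a_0 gives either order a
    correction in l_i l_j / l_0, symmetric in i and j. *)
Lemma DopC i j xi u : Dop i (Dop j xi) u = Dop j (Dop i xi) u.
Proof.
rewrite /Dop !coordB !coord_row !coord_a0.
rewrite -!addrA -!opprD [row j amat + row i amat]addrC [row j amat + a0]addrC.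
rewrite [row i amat + a0]addrC.
rewrite !rmorphB !rmorphM !rmorph_nat.
have [->|ij] := eqVneq i j; first by ring.
rewrite !mulr0n; ring.
Qed.

Lemma Dop_sum j (I : Type) (r : seq I) (c : I -> F) (f : I -> expo n -> F) u :
  Dop j (fun v => \sum_(i <- r) c i * f i v) u = \sum_(i <- r) c i * Dop j (f i) u.
Proof.
rewrite /Dop !mulr_sumr -sumrN -!big_split; apply: eq_bigr => i _ /=; ring.
Qed.

Lemma DformK w K u : Dform (Dform w) K u = 0.
Proof.
transitivity (\sum_(j in K) \sum_(i in K :\ j) (-1) ^+ before K j *
  ((-1) ^+ before (K :\ j) i * Dop j (Dop i (w (K :\ j :\ i))) u)).
  rewrite {1}/Dform; apply: eq_bigr => j jK.
  have -> : Dform w (K :\ j) = fun v => \sum_(i <- enum (K :\ j))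
      (-1) ^+ before (K :\ j) i * Dop i (w (K :\ j :\ i)) v.
    by apply/funext => v; rewrite big_enum.
  by rewrite Dop_sum mulr_sumr big_enum.
apply: sum_antisym => i j iK jK ij.
rewrite DopC !setDDl [[set i] :|: _]setUC.
by rewrite !mulrA sign_swap // mulNr.
Qed.

Lemma Dform_0 K u : Dform (fun _ _ => 0) K u = 0.
Proof. by rewrite /Dform big1 // => j _; rewrite /Dop !mulr0 addr0 subr0 mulr0. Qed.

Lemma Hform_0 J u : Hform (fun _ _ => 0) J u = 0.
Proof. by rewrite /Hform; case: freeidx => // j; rewrite mulr0 if_same. Qed.

Lemma DformD w w' K u :
  Dform (fun J x => w J x + w' J x) K u = Dform w K u + Dform w' K u.
Proof.
by rewrite -big_split; apply: eq_bigr => j _; rewrite /Dop /=; ring.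
Qed.

Lemma Dform_sum (I : Type) (r : seq I) (c : I -> F) v K u :
  Dform (fun J x => \sum_(i <- r) c i * v i J x) K u
  = \sum_(i <- r) c i * Dform (v i) K u.
Proof.
transitivity (\sum_(j in K) \sum_(i <- r)
    c i * ((-1) ^+ before K j * Dop j (v i (K :\ j)) u)).
  apply: eq_bigr => j _; rewrite Dop_sum mulr_sumr.
  by apply: eq_bigr => i _; rewrite mulrCA.
by rewrite exchange_big; apply: eq_bigr => i _; rewrite mulr_sumr.
Qed.

Lemma Hform_sum (I : Type) (r : seq I) (c : I -> F) v J u :
  Hform (fun K x => \sum_(i <- r) c i * v i K x) J u
  = \sum_(i <- r) c i * Hform (v i) J u.
Proof.
rewrite /Hform; case: freeidx => [j|].
  case: ifP => _; first by rewrite big1 // => i _; rewrite mulr0.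
  by rewrite mulr_sumr; apply: eq_bigr => i _; rewrite mulrCA.
by rewrite big1 // => i _; rewrite mulr0.
Qed.

Lemma Pform_sum (I : Type) (r : seq I) (c : I -> F) v J u :
  Pform (fun K x => \sum_(i <- r) c i * v i K x) J u
  = \sum_(i <- r) c i * Pform (v i) J u.
Proof.
by rewrite /Pform; case: ifP => // _; rewrite big1 // => i _; rewrite mulr0.
Qed.

Lemma Phi_sum (I : Type) (r : seq I) (c : I -> F) v J u :
  Phi (fun K x => \sum_(i <- r) c i * v i K x) J u
  = \sum_(i <- r) c i * Phi (v i) J u.
Proof.
rewrite /Phi Pform_sum.
have -> : Hform (fun K x => \sum_(i <- r) c i * v i K x) =
    fun K x => \sum_(i <- r) c i * Hform (v i) K x.
  by apply/funext => K; apply/funext => x; rewrite Hform_sum.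
have -> : Dform (fun K x => \sum_(i <- r) c i * v i K x) =
    fun K x => \sum_(i <- r) c i * Dform (v i) K x.
  by apply/funext => K; apply/funext => x; rewrite Dform_sum.
rewrite Dform_sum Hform_sum -!big_split.
by apply: eq_bigr => i _ /=; rewrite !mulrDr.
Qed.

Definition wt J u : R := \sum_j crd u j - #|J|%:R.

Lemma wtD1 K j u : j \in K -> wt (K :\ j) u = wt K u + 1.
Proof.
by move=> jK; rewrite /wt (cardsD1 j K) jK add1n -natr1; lra.
Qed.

Lemma sum_coord_row j : \sum_i crd (row j amat) i = 1.
Proof.
rewrite (bigD1 j) //= coord_row eqxx big1 ?addr0 // => i ij.
by rewrite coord_row eq_sym (negPf ij).
Qed.

(** The pairs [(K, u)] and [(K :\ j, u - row j amat)] have the same v, and weight and free index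
    depend on v alone. *)
Lemma wt_sub K j u : j \in K -> wt (K :\ j) (u - row j amat) = wt K u.
Proof.
move=> jK; rewrite wtD1 // /wt; under eq_bigr do rewrite coordB.
by rewrite sumrB sum_coord_row; lra.
Qed.

Lemma wt_add J j u : j \notin J -> wt (j |: J) (u + row j amat) = wt J u.
Proof.
by move=> jJ; rewrite -(wt_sub _ (setU11 j J)) addrK setU1K.
Qed.

Lemma freeidx_sub K j u : j \in K -> freeidx (K :\ j) (u - row j amat) = freeidx K u.
Proof.
move=> jK; apply: eq_pick => i /=; rewrite !inE coordB coord_row.
have [->|ij] := eqVneq i j; last by rewrite subr0.
by rewrite jK /= subr_ge0.
Qed.

Lemma freeidx_add J j u : j \notin J -> freeidx (j |: J) (u + row j amat) = freeidx J u.
Proof.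
by move=> jJ; rewrite -(freeidx_sub _ (setU11 j J)) addrK setU1K.
Qed.

Lemma Hform_vanish w t : (forall K x, t < wt K x -> w K x = 0) ->
  forall K x, t < wt K x -> Hform w K x = 0.
Proof.
move=> w0 K x ltx; rewrite /Hform; case: freeidx => // j.
by case: ifPn => // jK; rewrite w0 ?mulr0 // wt_add.
Qed.

End Generic.

(** * Leading behaviour at lambda = 0 *)

Section LambdaZero.
Variables (F : comPzRingType) (phi : {rmorphism R -> F}).
Implicit Types (w : {set 'I_m} -> expo n -> F).

(** The term with factor u'_j reads w in weight one higher, where it vanishes, and the x^(a_0) term
    carries the factor lambda = 0. *)
Lemma Dform0_top w K u : (forall J x, wt K u < wt J x -> w J x = 0) ->
  Dform phi 0 w K u =
  \sum_(j in K) (-1) ^+ before K j * ((l j)%:R * w (K :\ j) (u - row j amat)).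
Proof.
move=> w0; apply: eq_bigr => j jK; congr (_ * _).
rewrite /Dop w0 ?wtD1 ?ltrDl //; ring.
Qed.

Lemma phi_lK j : phi (l j)%:R^-1 * (l j)%:R = 1.
Proof.
by rewrite -(rmorph_nat phi) -rmorphM mulVf ?rmorph1 // pnatr_eq0 -lt0n.
Qed.

Lemma signK k : (-1) ^+ k * (-1) ^+ k = 1 :> F.
Proof. by rewrite -expr2 sqrr_sign. Qed.

Lemma Phi0_top w J u : (forall K x, wt J u < wt K x -> w K x = 0) ->
  Phi phi 0 w J u = w J u.
Proof.
move=> w0; rewrite /Phi Dform0_top; last exact: Hform_vanish.
case jE: (freeidx J u) => [j|]; last first.
  (* No free direction: the neighbours (J :\ i, u - a_i) share v, so H vanishes there too and only P
     remains. *)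
  rewrite {2}/Hform /Pform jE big1 ?add0r ?addr0 // => i iJ.
  by rewrite /Hform freeidx_sub // jE !mulr0.
rewrite {2}/Hform /Pform jE addr0.
case: ifPn => jJ.
  (* For j in J, H w has no component on sets containing j, so only the term i = j of D H w
     survives. *)
  rewrite addr0 (bigD1 j) //= big1 ?addr0 => [|i /andP[iJ ij]]; last first.
    by rewrite /Hform freeidx_sub // jE !inE eq_sym ij jJ !mulr0.
  rewrite /Hform freeidx_sub // jE !inE eqxx /= setD1K // subrK.
  rewrite [RHS](_ : _ = (-1) ^+ before J j * (-1) ^+ before J j
    * (phi (l j)%:R^-1 * (l j)%:R) * w J u); first by ring.
  by rewrite signK phi_lK !mul1r.
pose K := j |: J; have jK : j \in K by rewrite setU11.
have KJ : K :\ j = J by rewrite setU1K.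
rewrite -/K Dform0_top; last by move=> K' x; rewrite wt_add //; apply: w0.
rewrite [\sum_(i in K) _](bigD1 j) //= KJ addrK.
(* The terms i != j of D H w and H D w cancel, since the two orders of deletion carry opposite
   signs. *)
have -> : \sum_(i in J) (-1) ^+ before J i * ((l i)%:R * Hform phi w (J :\ i) (u - row i amat))
   = - ((-1) ^+ before K j * phi (l j)%:R^-1 * \sum_(i in K | i != j) (-1) ^+ before K i *
     ((l i)%:R * w (K :\ i) (u + row j amat - row i amat))).
  rewrite mulr_sumr -sumrN; apply: eq_big => [i|i iJ].
    by rewrite -KJ !inE andbC.
  have ij : i != j by apply: contraNneq jJ => <-.
  have iK : i \in K by rewrite !inE iJ orbT.
  have JiE : j |: J :\ i = K :\ i.
    by apply/setP => x; rewrite !inE; case: (eqVneq x j) => // ->; rewrite eq_sym ij.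
  rewrite /Hform freeidx_sub // jE !inE (negPf jJ) andbF JiE.
  rewrite [u + _ - _]addrAC.
  have := sign_swap F jK iK; rewrite eq_sym ij KJ => /(_ isT) sgn.
  rewrite [LHS](_ : _ = ((-1) ^+ before J i * (-1) ^+ before (K :\ i) j) * phi (l j)%:R^-1 *
     (l i)%:R * w (K :\ i) (u - row i amat + row j amat)); last by ring.
  rewrite [RHS](_ : _ = - ((-1) ^+ before K j * (-1) ^+ before K i) * phi (l j)%:R^-1 *
     (l i)%:R * w (K :\ i) (u - row i amat + row j amat)); last by ring.
  congr (_ * _ * _ * _).
  transitivity ((-1) ^+ before K j * (-1) ^+ before J i *
    ((-1) ^+ before K j * (-1) ^+ before (K :\ i) j) : F).
    by rewrite mulrACA signK mul1r.
  rewrite sgn; transitivity (- ((-1) ^+ before K j * (-1) ^+ before K i) *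
    ((-1) ^+ before (K :\ i) j * (-1) ^+ before (K :\ i) j) : F); first by ring.
  by rewrite signK mulr1.
rewrite mulrDr addrC -addrA subrr addr0.
rewrite [RHS](_ : _ = (-1) ^+ before K j * (-1) ^+ before K j
  * (phi (l j)%:R^-1 * (l j)%:R) * w J u); first by ring.
by rewrite signK phi_lK !mul1r.
Qed.

End LambdaZero.

(** * Change of coefficient ring *)

Section Morphism.
Variables (F F' : comPzRingType) (f : {rmorphism F -> F'}).
Variables (phi : {rmorphism R -> F}) (phi' : {rmorphism R -> F'}) (lm : F) (lm' : F').
Hypothesis phiE : forall x, phi' x = f (phi x).
Hypothesis lmE : lm' = f lm.

Lemma Dform_map (w : {set 'I_m} -> expo n -> F) K u :
  Dform phi' lm' (fun J x => f (w J x)) K u = f (Dform phi lm w K u).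
Proof.
rewrite rmorph_sum; apply: eq_bigr => j _.
by rewrite rmorphM rmorph_sign /Dop rmorphB rmorphD !rmorphM !rmorph_nat phiE lmE.
Qed.

Lemma Hform_map (w : {set 'I_m} -> expo n -> F) J u :
  Hform phi' (fun J x => f (w J x)) J u = f (Hform phi w J u).
Proof.
rewrite /Hform; case: freeidx => [j|]; last by rewrite rmorph0.
by case: ifP => _; rewrite ?rmorph0 // !rmorphM rmorph_sign phiE.
Qed.

Lemma Phi_map (w : {set 'I_m} -> expo n -> F) J u :
  Phi phi' lm' (fun J x => f (w J x)) J u = f (Phi phi lm w J u).
Proof.
rewrite /Phi !rmorphD -Dform_map -Hform_map.
rewrite (_ : Pform _ J u = f (Pform w J u)); last first.
  by rewrite /Pform; case: ifP; rewrite ?rmorph0.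
congr (Dform _ _ _ _ _ + Hform _ _ _ _ + _); apply/funext => K; apply/funext => x.
  exact: Hform_map.
exact: Dform_map.
Qed.

End Morphism.

(** * Monomials of the complex and forms of bounded weight *)

Definition valid J u :=
  [&& inV u, [forall j, 0 <= crd u j] & [forall (j | j \in J), 0 < crd u j]].

Lemma validP J u : reflect
  [/\ inV u, forall j, 0 <= crd u j & forall j, j \in J -> 0 < crd u j] (valid J u).
Proof.
apply: (iffP and3P) => [[uV /forallP u0 /forall_inP uJ]|[uV u0 uJ]]; split=> //.
  exact/forallP.
exact/forall_inP.
Qed.

(** Every j outside J is free, because there v'_j = u'_j >= 0; for j in J, failing the test means
    u'_j < 1. *)
Lemma freeidxN J u j : valid J u -> freeidx J u = None -> j \in J /\ crd u j < 1.
Proof.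
move=> /validP[_ u0 _]; rewrite /freeidx; case: pickP => // /(_ j).
have [jJ /negbT|jJ] := boolP (j \in J); last by rewrite /= u0.
by rewrite -ltNge.
Qed.

(** The k-forms of the complex in weight at most c. The bound on the weight encodes finite support,
    see [in_KP]. *)
Definition adm (F : nmodType) k (c : R) (w : {set 'I_m} -> expo n -> F) :=
  forall J u, w J u != 0 -> [/\ valid J u, #|J| = k & wt J u <= c].

Section Admissible.
Variables (F : comPzRingType) (phi : {rmorphism R -> F}) (lm : F).
Implicit Types (w : {set 'I_m} -> expo n -> F).

(** Each term of D_j makes u'_j positive: the first survives only if u'_j is nonzero, the second
    adds 1 to it, the third adds l_j / l_0. The first lowers the weight by 1, the others preserve
    it. *)
Lemma Dform_adm k c w : adm k c w -> adm k.+1 c (Dform phi lm w).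
Proof.
move=> wa K u; case: (pselect (exists2 j, j \in K & Dop phi lm j (w (K :\ j)) u != 0)).
  move=> [j jK nz _]; have cK : #|K| = (#|K :\ j|).+1 by rewrite (cardsD1 j) jK.
  have [/andP[cn0 /wa[/validP[uV u0 uJ] ck wc]]|] :=
      boolP ((crd u j != 0) && (w (K :\ j) u != 0)).
    split; [apply/validP; split=> // i iK|by rewrite cK ck|].
      have [->|ij] := eqVneq i j; first by rewrite lt_def cn0 u0.
      by apply: uJ; rewrite !inE ij.
    by apply: le_trans wc; rewrite wtD1 // lerDl.
  rewrite negb_and !negbK => z1.
  have [/wa[/validP[uV u0 uJ] ck wc]|/negPn/eqP z2] := boolP (w (K :\ j) (u - row j amat) != 0).
    have coordE i : crd u i = crd (u - row j amat) i + (j == i)%:R.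
      by rewrite coordB coord_row subrK.
    split; [apply/validP; split|by rewrite cK ck|by rewrite -(wt_sub u jK)].
    - by rewrite -(subrK (row j amat) u) inVD // inV_row.
    - by move=> i; rewrite coordE addr_ge0.
    - move=> i iK; rewrite coordE.
      have [ij|ij] := eqVneq j i; first by rewrite ltr_wpDl.
      by rewrite addr0 uJ // !inE eq_sym ij.
  have [/wa[/validP[uV u0 uJ] ck wc]|/negPn/eqP z3] := boolP (w (K :\ j) (u - a0) != 0).
    have l0R : 0 < l0%:R :> R by rewrite ltr0n.
    have coordE i : crd u i = crd (u - a0) i + (l i)%:R / l0%:R.
      by rewrite coordB coord_a0 subrK.
    have pos i : 0 < crd u i by rewrite coordE ltr_wpDl // divr_gt0 // ltr0n.
    split; [apply/validP; split=> //|by rewrite cK ck|].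
    - by rewrite -(subrK a0 u) inVD // inV_a0.
    - by move=> i; apply: ltW.
    (* The coordinates of a_0 sum to 1, which offsets the additional element of K. *)
    - apply: le_trans wc; rewrite /wt cK -natr1 (eq_bigr _ (fun i _ => coordE i)).
      rewrite big_split -mulr_suml -natr_sum -l0_sum divff /= ?gt_eqF //.
      by rewrite opprD addrACA subrr addr0.
  move: nz; rewrite /Dop z2 z3 !mulr0 !subr0 addr0.
  by case/orP: z1 => /eqP->; rewrite ?rmorph0 ?mul0r ?mulr0 eqxx.
move=> nex /negP[]; apply/eqP; rewrite /Dform big1 // => j jK.
have [->|nz] := eqVneq (Dop phi lm j (w (K :\ j)) u) 0; first by rewrite mulr0.
by case: nex; exists j.
Qed.

Lemma Hform_neq0 w J u : Hform phi w J u != 0 -> exists j,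
  [/\ freeidx J u = Some j, j \notin J & w (j |: J) (u + row j amat) != 0].
Proof.
rewrite /Hform; case: freeidx => [j|]; last by rewrite eqxx.
case: ifPn => jJ; first by rewrite eqxx.
by move=> nz; exists j; split=> //; apply: contraNneq nz => ->; rewrite mulr0.
Qed.

(** Subtracting a_j could leave the cone; the test defining a free index guarantees u'_j >= 0
    afterwards, which suffices as j is no longer in the index set. *)
Lemma Hform_adm k c w : adm k.+1 c w -> adm k c (Hform phi w).
Proof.
move=> wa J u /Hform_neq0[j [jE jJ /wa[/validP[uV u0 uJ] ck wc]]].
have coordE i : crd (u + row j amat) i = crd u i + (j == i)%:R.
  by rewrite coordD coord_row.
have uj : 0 <= crd u j.
  by move: jE; rewrite /freeidx; case: pickP => // i + [<-]; apply: le_trans.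
split; last by rewrite -(wt_add u jJ).
  apply/validP; split.
  - by rewrite -(addrK (row j amat) u) inVB // inV_row.
  - move=> i; have [<-//|ij] := eqVneq j i.
    by have := u0 i; rewrite coordE (negPf ij) addr0.
  - move=> i iJ; have ij : j != i by apply: contraNneq jJ => ->.
    by have := uJ i; rewrite coordE (negPf ij) addr0; apply; rewrite !inE iJ orbT.
by apply: succn_inj; rewrite -ck cardsU1 jJ.
Qed.

Lemma Hform_adm0 c w J u : adm 0 c w -> Hform phi w J u = 0.
Proof.
move=> wa; apply/eqP; apply: contraT => /Hform_neq0[j [_ jJ /wa[_]]].
by rewrite cardsU1 jJ.
Qed.

Lemma Phi_adm k c w : adm k c w -> adm k c (Phi phi lm w).
Proof.
move=> wa J u; rewrite /Phi.
have [->|nz _] := eqVneq (Dform phi lm (Hform phi w) J u) 0; last first.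
  case: k wa => [|k] wa; last exact: Dform_adm (Hform_adm wa) _ _ nz.
  case/eqP: nz; rewrite (_ : Hform phi w = fun _ _ => 0).
    exact: Dform_0.
  by apply/funext => K; apply/funext => x; apply: Hform_adm0 wa.
have [->|nz _] := eqVneq (Hform phi (Dform phi lm w) J u) 0; last first.
  exact: Hform_adm (Dform_adm wa) _ _ nz.
by rewrite !add0r /Pform; case: ifP => [|_ /wa//]; rewrite eqxx.
Qed.

End Admissible.

(** * Finiteness of the pieces of bounded weight *)

Lemma finite_coord_box (c : R) : exists s : seq (expo n), forall u,
  inV u -> (forall j, 0 <= crd u j <= c) -> u \in s.
Proof.
(* Summing over all columns q gives a single bound valid for every entry of u. *)
pose B : R := \sum_q \sum_j c * `|(intmxR R amat) j q|.
have [s sP] := bounded_int_rows n (Num.bound B).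
exists s => u uV uc; apply: sP => q.
have term_ge0 p j : 0 <= c * `|(intmxR R amat) j p|.
  by apply: mulr_ge0 => //; case/andP: (uc j); apply: le_trans.
rewrite -(ler_int R) intr_norm; apply: (@le_trans _ _ B); last first.
  rewrite -pmulrn; apply/ltW/archi_boundP.
  by apply: sumr_ge0 => p _; apply: sumr_ge0.
have -> : (u 0 q)%:~R = intmxR R u 0 q by rewrite mxE.
rewrite (inVP _ uV) mxE; apply: le_trans (ler_norm_sum _ _ _) _.
rewrite /B (bigD1 q) //=; apply: (@le_trans _ _ (\sum_j c * `|(intmxR R amat) j q|)).
  apply: ler_sum => j _; rewrite normrM mxE; apply: ler_wpM2r => //.
  by case/andP: (uc j) => c0 cc; rewrite ger0_norm.
by rewrite lerDl; apply: sumr_ge0 => p _; apply: sumr_ge0.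
Qed.

Lemma finite_basis k (c : R) : exists s : seq ({set 'I_m} * expo n),
  uniq s /\ forall J u,
    ((J, u) \in s) = [&& valid J u, #|J| == k & wt J u <= c].
Proof.
(* Each u'_j is at most the sum of all coordinates, which is at most c + |J| <= c + m. *)
have [s sP] := finite_coord_box (c + m%:R).
pose t := [seq (J, u) | J <- enum {set 'I_m}, u <- s].
exists [seq x <- undup t | [&& valid x.1 x.2, #|x.1| == k & wt x.1 x.2 <= c]].
split=> [|J u]; first by rewrite filter_uniq ?undup_uniq.
rewrite mem_filter mem_undup andb_idr //= => /and3P[/validP[uV u0 _] _ uc].
apply: allpairs_f; first by rewrite mem_enum.
apply: sP => // j; rewrite u0 /=.
have : crd u j <= \sum_i crd u i.
  by rewrite (bigD1 j) //= lerDl sumr_ge0.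
have : #|J|%:R <= m%:R :> R by rewrite ler_nat -[X in (_ <= X)%N]card_ord max_card.
by move: uc; rewrite /wt; lra.
Qed.

(** * The matrix of Phi on a finite set of monomials *)

Section Matrix.
Variables (s : seq ({set 'I_m} * expo n)).
Local Notation N := (size s).
Local Notation x_ i := (tnth (in_tuple s) i).

Definition dlt (F : pzSemiRingType) (y : {set 'I_m} * expo n) :
  {set 'I_m} -> expo n -> F := fun J u => ((J, u) == y)%:R.

(* phi and lm are generic so that the matrix over C[lambda] specializes both to
   C(lambda) and to lambda = 0. *)
Definition mxPhi (F : comPzRingType) (phi : {rmorphism R -> F}) (lm : F) : 'M[F]_N :=
  \matrix_(i, j) Phi phi lm (dlt F (x_ j)) (x_ i).1 (x_ i).2.

Definition cvec (F : comPzRingType) (w : {set 'I_m} -> expo n -> F) : 'cV[F]_N :=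
  \col_i w (x_ i).1 (x_ i).2.

Hypothesis s_uniq : uniq s.

Lemma mxPhi_map (F F' : comPzRingType) (f : {rmorphism F -> F'})
    (phi : {rmorphism R -> F}) (phi' : {rmorphism R -> F'}) lm lm' :
  (forall x, phi' x = f (phi x)) -> lm' = f lm ->
  mxPhi phi' lm' = map_mx f (mxPhi phi lm).
Proof.
move=> phiE lmE; apply/matrixP => i j; rewrite !mxE -(Phi_map phiE lmE).
congr (Phi _ _ _ _ _); apply/funext => J; apply/funext => u.
by rewrite /dlt rmorph_nat.
Qed.

(** A column monomial of weight at most that of the row vanishes above the row's weight, so
    [Phi0_top] gives an entry of the identity matrix, ties in weight included. *)
Lemma mxPhi0_unit (K : fieldType) (phi : {rmorphism R -> K}) : mxPhi phi 0 \in unitmx.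
Proof.
apply: (@unitriangular_unit _ R _ _ (fun p => wt (x_ p).1 (x_ p).2)) => p q le_ji.
rewrite mxE Phi0_top => [|J u lt_iJ].
  by rewrite /dlt -surjective_pairing (inj_eq _) //; apply/tuple_uniqP.
rewrite /dlt; case: eqP => // E; move: lt_iJ; rewrite ltNge.
by rewrite (_ : wt J u = wt (x_ q).1 (x_ q).2) ?le_ji // -E.
Qed.

Lemma cvecK (F : comPzRingType) (w : {set 'I_m} -> expo n -> F) :
  (forall J u, w J u != 0 -> (J, u) \in s) ->
  w = fun J u => \sum_i cvec w i 0 * dlt F (x_ i) J u.
Proof.
move=> ws; apply/funext => J; apply/funext => u.
have [/tnthP[i xi]|Jus] := boolP ((J, u) \in in_tuple s); last first.
  rewrite big1 => [|i _]; first by apply/eqP; apply: contraNT Jus; apply: ws.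
  rewrite /dlt; case: eqP => [E|]; last by rewrite mulr0.
  by rewrite E mem_tnth in Jus.
rewrite (bigD1 i) //= big1 ?addr0 => [|j ji].
  by rewrite /dlt xi eqxx mulr1 mxE -xi.
by rewrite /dlt xi (inj_eq _) ?[i == j]eq_sym ?(negPf ji) ?mulr0 //; apply/tuple_uniqP.
Qed.

Lemma cvec_Phi (F : comPzRingType) (phi : {rmorphism R -> F}) lm w :
  (forall J u, w J u != 0 -> (J, u) \in s) ->
  cvec (Phi phi lm w) = mxPhi phi lm *m cvec w.
Proof.
move=> ws; apply/matrixP => i z; rewrite ord1 !mxE {1}(cvecK ws) Phi_sum.
by apply: eq_bigr => j _; rewrite [in RHS]mxE mulrC.
Qed.

End Matrix.

(** * Bijectivity of Phi over C(lambda) *)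

Definition phiP : {rmorphism R -> {poly R[i]}} := polyC \o real_complex R.
Definition phiF : {rmorphism R -> Clam R} := @tofrac _ \o polyC \o real_complex R.

Lemma mxPhi_unit s : uniq s -> mxPhi s phiF (lam R) \in unitmx.
Proof.
move=> s_uniq.
rewrite (@mxPhi_map s _ _ (@tofrac {poly R[i]}) phiP phiF 'X) //.
apply: unitmx_tofrac.
rewrite -(@mxPhi_map s _ _ (horner_eval (0 : R[i])) phiP (real_complex R) 'X 0) //.
- exact: mxPhi0_unit.
- by move=> x; rewrite /= /horner_eval hornerC.
- by rewrite /= /horner_eval hornerX.
Qed.

Lemma Phi_inj k c w w' : adm k c w -> adm k c w' ->
  (forall J u, Phi phiF (lam R) w J u = Phi phiF (lam R) w' J u) -> w = w'.
Proof.
move=> wa wa' ww'; have [s [s_uniq sP]] := finite_basis k c.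
have as_ (t : Defs.form R n m) : adm k c t -> forall K x, t K x != 0 -> (K, x) \in s.
  by move=> ta K x /ta[v /eqP ck wc]; rewrite sP v ck.
rewrite (cvecK s_uniq (as_ _ wa)) (cvecK s_uniq (as_ _ wa')).
have cvecE (t : Defs.form R n m) : adm k c t ->
    cvec s t = invmx (mxPhi s phiF (lam R)) *m cvec s (Phi phiF (lam R) t).
  by move=> ta; rewrite (cvec_Phi s_uniq phiF _ (as_ _ ta)) mulKmx ?mxPhi_unit.
rewrite (cvecE _ wa) (cvecE _ wa') (_ : cvec s _ = cvec s (Phi phiF (lam R) w')) //.
by apply/matrixP => i o; rewrite !mxE ww'.
Qed.

Lemma Phi_surj k c t : adm k c t -> exists2 z, adm k c z &
  forall J u, Phi phiF (lam R) z J u = t J u.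
Proof.
move=> ta; have [s [s_uniq sP]] := finite_basis k c.
have as_ (w : Defs.form R n m) : adm k c w -> forall K x, w K x != 0 -> (K, x) \in s.
  by move=> wa K x /wa[v /eqP ck wc]; rewrite sP v ck.
pose b := invmx (mxPhi s phiF (lam R)) *m cvec s t.
pose z J u := \sum_i b i 0 * dlt (Clam R) (tnth (in_tuple s) i) J u.
have za : adm k c z.
  move=> J u nz; suff : (J, u) \in in_tuple s.
    by rewrite sP => /and3P[? /eqP].
  apply: contraNT nz => Jus; rewrite /z big1 // => i _; rewrite /dlt.
  by case: eqP => [E|_]; [rewrite E mem_tnth in Jus|rewrite mulr0].
exists z => // J u.
have zb : cvec s z = b.
  apply/matrixP => i o; rewrite ord1 mxE /z (bigD1 i) //= /dlt -surjective_pairing eqxx mulr1.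
  rewrite big1 ?addr0 // => j ji.
  by rewrite (inj_eq _) ?[i == j]eq_sym ?(negPf ji) ?mulr0 //; apply/tuple_uniqP.
have Pza : adm k c (Phi phiF (lam R) z) by apply: Phi_adm.
rewrite (cvecK s_uniq (as_ _ Pza)) (cvecK s_uniq (as_ _ ta)).
rewrite (cvec_Phi s_uniq phiF _ (as_ _ za)).
by rewrite zb /b mulKVmx // mxPhi_unit.
Qed.

(** * Cones, box and complex in terms of coordinates *)

Lemma in_coneP B u : in_cone R amat B u <->
  [/\ inV u, forall j, 0 <= crd u j & forall j, j \notin B -> crd u j = 0].
Proof.
split=> [[c [c0 [cB uE]]]|[uV u0 uB]].
  split; first by rewrite /inV uE submxMl.
  - by move=> j; rewrite (coord_cone uE).
  - by move=> j /cB; rewrite (coord_cone uE).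
exists (\row_j crd u j); split; first by move=> j; rewrite mxE.
by split; [move=> j jB; rewrite mxE uB|apply/inVP].
Qed.

Lemma in_BsetP u : in_Bset R amat u <-> inV u /\ forall j, 0 <= crd u j < 1.
Proof.
split=> [[c [c01 uE]]|[uV u01]].
  split; first by rewrite /inV uE submxMl.
  by move=> j; rewrite (coord_cone uE).
exists (\row_j crd u j); split; first by move=> j; rewrite mxE.
exact/inVP.
Qed.

(** Finite support bounds the weights; conversely, only finitely many monomials of degree k have
    weight at most c. *)
Lemma in_KP k (w : Defs.form R n m) : in_K amat k w <-> exists c, adm k c w.
Proof.
split=> [wK|[c wa] J].
  have /fin_all_exists[s sP] : forall J, exists s : seq (expo n), forall u, w J u != 0 -> u \in s.
    move=> J; have := wK J; case: ifP => _ => [[[s sP] _]|w0]; first by exists s.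
    by exists [::] => u; rewrite w0 eqxx.
  exists (\sum_J \sum_(u <- s J) `|wt J u|) => J u nz.
  have := wK J; case: eqP => [cJ [_ /(_ u nz)[uM uJ]]|_ w0]; last by rewrite w0 eqxx in nz.
  have [uV u0 _] := (in_coneP _ _).1 uM.
  split=> //; first exact/validP.
  apply: le_trans (ler_norm _) _; rewrite (bigD1 J) //= (big_rem u) /= ?sP //.
  rewrite -addrA lerDl addr_ge0 ?sumr_ge0 // => K _; exact: sumr_ge0.
case: eqP => [cJ|cJ u]; last first.
  by apply/eqP; apply: contraT => /wa[_ /cJ].
split=> [|u /wa[/validP[uV u0 uJ] _ _]]; last first.
  by split=> //; apply/in_coneP; split=> // j; rewrite inE.
have [s [_ sP]] := finite_basis k c.
exists [seq x.2 | x <- s] => u /wa[uv ck uc].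
by apply/mapP; exists (J, u) => //; rewrite sP uv ck eqxx.
Qed.

(** The degree is tied to a successor by an equation so that this applies to k = m, on which the
    type ['I_m] depends. *)
Lemma coboundaryS k k' w : k = k'.+1 -> coboundary amat a0 l k w <->
  exists v, in_K amat k' v /\ Dform phiF (lam R) v = w.
Proof.
move=> ->; split=> [[v [vK vE]]|[v [vK vE]]]; exists v; split=> //.
  by apply/funext => J; apply/funext => u; apply: vE.
by rewrite -vE.
Qed.

Lemma coboundary_closed k w : coboundary amat a0 l k w -> Dform phiF (lam R) w = fun _ _ => 0.
Proof.
move=> wb; apply/funext => J; apply/funext => u; case: k wb => [w0|k].
  rewrite (_ : w = fun _ _ => 0) ?Dform_0 //.
  by apply/funext => K; apply/funext => x; apply: w0.
by move=> /(coboundaryS _ erefl)[v [_ <-]]; apply: DformK.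
Qed.

(** * Exactness below degree m *)

Lemma freeidx_setT J u : valid J u -> freeidx J u = None -> J = setT.
Proof.
by move=> v fN; apply/setP => j; rewrite inE; have [] := freeidxN j v fN.
Qed.

Lemma Pform_adm0 k c (w : Defs.form R n m) J u : (k < m)%N -> adm k c w -> Pform w J u = 0.
Proof.
move=> km wa; rewrite /Pform; case fE: (freeidx J u) => //=.
apply/eqP; apply: contraT => /wa[v cJ _]; move: km.
by rewrite -cJ (freeidx_setT v fE) cardsT card_ord ltnn.
Qed.

(** Here Phi w = D H w. Solving Phi z = H w gives Phi (D z) = D H D z = D (Phi z) = D H w = Phi w,
    so D z = w by injectivity. Assuming H D w = 0 instead of D w = 0 lets [top_dim] apply this to a
    form not yet known to be closed. *)
Lemma exact_below_top k c w : (k < m)%N -> adm k c w ->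
  (forall J u, Hform phiF (Dform phiF (lam R) w) J u = 0) -> coboundary amat a0 l k w.
Proof.
move=> km wa HD0.
have PhiE J u : Phi phiF (lam R) w J u = Dform phiF (lam R) (Hform phiF w) J u.
  by rewrite /Phi HD0 (Pform_adm0 _ _ km wa) !addr0.
case: k km wa => [|k] km wa.
  (* In degree 0, H w = 0, hence Phi w = 0. *)
  have -> : w = fun _ _ => 0; last by [].
  apply: (Phi_inj wa) => [J u|J u]; first by rewrite eqxx.
  have H0 : Hform phiF w = fun _ _ => 0.
    by apply/funext => K; apply/funext => x; apply: Hform_adm0 wa.
  rewrite PhiE H0 /Phi (_ : Hform phiF (fun _ _ => 0) = fun _ _ => 0); last first.
    by apply/funext => K; apply/funext => x; apply: Hform_0.
  rewrite (_ : Dform _ _ (fun _ _ => 0) = fun _ _ => 0); last first.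
    by apply/funext => K; apply/funext => x; apply: Dform_0.
  by rewrite Hform_0 /Pform if_same !addr0.
have [z za zE] := Phi_surj (Hform_adm (phi := phiF) wa).
apply/(coboundaryS _ erefl); exists z; split; first by apply/in_KP; exists c.
apply: Phi_inj (Dform_adm za) wa _ => J u; rewrite PhiE.
have -> : Hform phiF w = fun J u => Dform phiF (lam R) (Hform phiF z) J u +
    Hform phiF (Dform phiF (lam R) z) J u.
  apply/funext => K; apply/funext => x; rewrite -zE /Phi.
  by rewrite (Pform_adm0 _ _ (ltnW km) za) addr0.
rewrite DformD DformK add0r /Phi (Pform_adm0 _ _ km (Dform_adm za)) addr0.
rewrite (_ : Dform _ _ (Dform _ _ z) = fun _ _ => 0) ?Hform_0 ?addr0 //.
by apply/funext => K; apply/funext => x; apply: DformK.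
Qed.

Lemma vanishing_below_top k : (k < m)%N -> H_vanishes R amat a0 l k.
Proof.
move=> km w [/in_KP[c wa] w0]; apply: exact_below_top km wa _ => J u.
rewrite (_ : Dform _ _ w = fun _ _ => 0) ?Hform_0 //.
by apply/funext => K; apply/funext => x; apply: w0.
Qed.

(** * The basis of H^m and the count of the open box *)

Definition in_box u := inV u && [forall j, 0 < crd u j < 1].

Lemma freeidx_box u : in_box u -> freeidx setT u = None.
Proof.
move=> /andP[_ /forallP u01]; rewrite /freeidx; case: pickP => // j.
by rewrite inE /= leNgt; have /andP[_ ->] := u01 j.
Qed.

Lemma box_valid J u : valid J u -> freeidx J u = None -> in_box u.
Proof.
move=> v fN; have [uV u0 uJ] := validP _ _ v; rewrite /in_box uV.
by apply/forallP => j; have [jJ ->] := freeidxN j v fN; rewrite uJ.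
Qed.

Lemma top_dim (s : seq (expo n)) : uniq s -> (forall u, (u \in s) = in_box u) ->
  H_dim R amat a0 l m (size s).
Proof.
move=> s_uniq sP.
(* For m = 0 the sum giving l_0 would be empty, against l_0 > 0. *)
have [m' mE] : exists m', m = m'.+1.
  case: m l l0_sum l0_gt0 => [l' -> |m' _ _ _]; last by exists m'.
  by rewrite big_ord0.
have m'm : (m' < m)%N by rewrite mE.
have above k c (w : Defs.form R n m) : (m < k)%N -> adm k c w -> w = fun _ _ => 0.
  move=> mk wa; apply/funext => J; apply/funext => u; apply/eqP; apply: contraT.
  move=> /wa[_ cJ _]; move: mk.
  by rewrite -cJ ltnNge -[X in (_ <= X)%N]card_ord max_card.
pose b (p : 'I_(size s)) := tnth (in_tuple s) p.
have b_box p : in_box (b p) by rewrite -sP mem_tnth.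
pose v p := dlt (Clam R) ([set: 'I_m], b p).
have v_adm p : in_K amat m (v p).
  apply/in_KP; exists (wt setT (b p)) => J u; rewrite /v /dlt.
  case: ((J, u) =P _) => [[-> ->] _|]; last by rewrite eqxx.
  have /andP[bV /forallP b01] := b_box p.
  split=> //; last by rewrite cardsT card_ord.
  by apply/validP; split=> // j; have /andP[b0 _] := b01 j; [exact: ltW|].
exists v; split; [|split] => [p|w [/in_KP[c wa] w0]|c].
- split=> // J u; have [c va] := (in_KP _ _).1 (v_adm p).
  exact: (congr1 (fun f => f J u) (above _ _ _ (ltnSn m) (Dform_adm (phi := phiF) (lm := lam R) va))).
(* Spanning: w = Phi z = D H z + P z, since D z has degree m + 1 and vanishes; P z is a combination
   of box monomials with the coefficients of z. *)
- have [z za zE] := Phi_surj wa; exists (fun p => z setT (b p)).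
  apply/(coboundaryS _ mE); exists (Hform phiF z); split.
    by apply/in_KP; exists c; apply: Hform_adm; rewrite -mE.
  apply/funext => J; apply/funext => u; rewrite -zE /Phi.
  rewrite (above _ _ _ (ltnSn m) (Dform_adm (phi := phiF) (lm := lam R) za)) Hform_0 addr0.
  apply/esym/eqP; rewrite subr_eq (inj_eq (addrI _)); apply/eqP.
  rewrite /lincomb /v /dlt /Pform.
  have [/andP[/eqP-> us]|nbox] := boolP ((J == setT) && (u \in s)).
    rewrite freeidx_box -?sP //=.
    have /tnthP[p up] : u \in in_tuple s by [].
    rewrite (bigD1 p) //= -/(b p) up eqxx mulr1 big1 ?addr0 // => q qp.
    rewrite xpair_eqE eqxx (inj_eq _) ?[p == q]eq_sym ?(negPf qp) ?mulr0 //.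
    exact/tuple_uniqP.
  rewrite big1 => [|p _]; last first.
    case: eqP => [[JT ub]|_]; last by rewrite mulr0.
    by rewrite JT ub eqxx sP b_box in nbox.
  case fE: (freeidx J u) => //=; apply/eqP; apply: contraT => /za[uv _ _].
  by rewrite (freeidx_setT uv fE) eqxx sP (box_valid uv fE) in nbox.
- move=> /(coboundaryS _ mE)[y [/in_KP[c' ya] yE]] p.
  (* Independence: if the combination equals D y, then H kills it, so y is itself a coboundary and D
     y = 0. *)
  have yb : coboundary amat a0 l m' y.
    apply: exact_below_top m'm ya _ => J u; rewrite yE.
    (* H only reads monomials whose v has a free direction, and box monomials have none. *)
    apply/eqP; apply: contraT => /Hform_neq0[j [jE jJ /negP[]]]; apply/eqP.
    rewrite /lincomb big1 // => q _; rewrite /v /dlt.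
    case: eqP => [[JT ub]|_]; last by rewrite mulr0.
    by have := freeidx_add u jJ; rewrite jE JT ub freeidx_box.
  have := coboundary_closed yb; rewrite yE => /(congr1 (fun f => f setT (b p))).
  rewrite /lincomb (bigD1 p) //= /v /dlt eqxx mulr1 big1 ?addr0 // => q qp.
  rewrite xpair_eqE eqxx (inj_eq _) ?[p == q]eq_sym ?(negPf qp) ?mulr0 //.
  exact/tuple_uniqP.
Qed.

(** A point u of the half-open box lies in C(B) exactly when its support is contained in B. After
    exchanging the sums, [sum_superset_sign] keeps only the points of full support, those of the
    open box. *)
Lemma box_count : exists (s : seq (expo n)) (N : {set 'I_m} -> nat),
  [/\ uniq s, forall u, (u \in s) = in_box u,
    forall B, counts (fun u => in_Bset R amat u /\ in_cone R amat B u) (N B) &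
    (size s)%:Z = \sum_(B : {set 'I_m}) (-1) ^+ (m - #|B|) * (N B)%:Z].
Proof.
have [s0 s0P] := finite_coord_box 1.
pose cube u := inV u && [forall j, 0 <= crd u j < 1].
pose s := [seq u <- undup s0 | cube u].
have s_uniq : uniq s by rewrite filter_uniq ?undup_uniq.
have sP u : (u \in s) = cube u.
  rewrite mem_filter mem_undup andb_idr // => /andP[uV /forallP u01].
  by apply: s0P => // j; have /andP[-> /ltW] := u01 j.
pose supp u := [set j | crd u j != 0].
exists [seq u <- s | supp u == setT], (fun B : {set 'I_m} => count (fun u => supp u \subset B) s).
split.
- exact: filter_uniq.
- move=> u; rewrite mem_filter sP /cube /in_box andbCA; congr (_ && _).
  apply/andP/forallP => [[/eqP uT /forallP u01] j|u01].
    have /andP[u0 ->] := u01 j; rewrite andbT lt_def u0 andbT.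
    by have := in_setT j; rewrite -uT inE.
  split; last by apply/forallP => j; have /andP[/ltW-> ->] := u01 j.
  by apply/eqP/setP => j; rewrite !inE gt_eqF //; have /andP[] := u01 j.
- move=> B; exists [seq u <- s | supp u \subset B].
  split; first exact: filter_uniq.
  split; last by rewrite size_filter.
  move=> u; rewrite mem_filter sP; split.
    move=> /and3P[/subsetP uB uV /forallP u01]; split; first exact/in_BsetP.
    apply/in_coneP; split=> // j; first by have /andP[] := u01 j.
    by move=> jB; apply/eqP; apply: contraNT jB => nz; apply: uB; rewrite inE.
  move=> [/in_BsetP[uV u01] /in_coneP[_ _ uB]]; rewrite /cube uV.
  apply/and3P; split=> //; last exact/forallP.
  by apply/subsetP => j; rewrite inE; apply: contraNT => /uB ->.
rewrite size_filter count_int_sum.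
under [RHS]eq_bigr do rewrite count_int_sum mulr_sumr.
rewrite exchange_big; apply: eq_bigr => u _ /=.
rewrite -sum_superset_sign big_mkcond; apply: eq_bigr => B _.
by case: ifP; rewrite ?mulr1 ?mulr0.
Qed.

End Operators.

Theorem theorem9p8 (R : realType) (n m : nat) (amat : 'M[int]_(m, n))
  (a0 : 'rV[int]_n) (l0 : nat) (l : 'I_m -> nat) :
  row_free (intmxR R amat) ->
  (0 < l0)%N -> (forall j, (0 < l j)%N) ->
  gcdn l0 (\big[gcdn/0%N]_(j < m) l j) = 1%N ->
  (l0%:Z) *: a0 = \sum_(j < m) (l j)%:Z *: row j amat ->
  l0 = (\sum_(j < m) l j)%N ->
  (forall i, (i < m)%N -> H_vanishes R amat a0 l i) /\
  exists (d : nat) (N : {set 'I_m} -> nat),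
    H_dim R amat a0 l m d /\
    (forall B, counts (fun u => in_Bset R amat u /\ in_cone R amat B u) (N B)) /\
    d%:Z = \sum_(B : {set 'I_m}) (-1) ^+ (m - #|B|) * (N B)%:Z.
Proof.
move=> free_amat l0_gt0 l_gt0 _ l0a0 l0_sum; split=> [k km|].
  exact: (vanishing_below_top free_amat l0_gt0 l_gt0 l0a0 l0_sum km).
have [s [N [s_uniq sP NP sE]]] := box_count free_amat.
exists (size s), N; split=> //.
exact: (top_dim free_amat l0_gt0 l_gt0 l0a0 l0_sum s_uniq sP).
Qed.
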